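(* For every transposition sequence $\mathbf{s}=\langle s_1,\ldots,s_m\rangle$ over $\mathbf{S}_n$, the Mind-Body Dual of $\mathbf{s}$ is the same as the Trail Dual of $\mathbf{s}$ (where the Trail Dual, a labeled graph, is viewed as a transposition sequence).
   Context: $\mathbf{S}_n$ is the symmetric group on $[n]=\{1,\ldots,n\}$; permutations are multiplied from left to right (in $p\cdot q$, $p$ is applied first). A transposition sequence over $\mathbf{S}_n$ is a finite sequence $\langle s_1,\ldots,s_m\rangle$ of transpositions of $\mathbf{S}_n$. Mind-Body Dual: A Mind-Body Assignment over $n$ is a permutation $A\in\mathbf{S}_n$, thought of as mapping each mind $M$ to the body $A(M)$; one says $M$ is above $A(M)$. For a transposition $(x,y)$, the body-swapping operation turns $A$ into the assignment in which the bodies $x$ and $y$ are exchanged (the mind that was above $x$ is now above $y$ and vice versa; all else unchanged). Given $\mathbf{s}=\langle s_1,\ldots,s_m\rangle$, let $A_0$ be the identity and let $A_k$ be the result of applying to $A_{k-1}$ the body-swapping operation with $s_k$. The Mind-Body Dual of $\mathbf{s}$ is $\langle s_1',\ldots,s_m'\rangle$, where, if $s_k=(x,y)$, then $s_k'=(x',y')$ with $x'$ above $x$ and $y'$ above $y$ in $A_{k-1}$. Graphs: a graph is finite and loopless, with multi-edges allowed. A labeled graph has its $n$ vertices labeled bijectively by $[n]$ and its $m$ edges labeled bijectively by $[m]$. Transposition sequences over $\mathbf{S}_n$ of length $m$ are identified with labeled graphs on vertex set $[n]$ with $m$ edges: $s_i=(x_i,y_i)$ corresponds to an edge labeled $i$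 between $x_i$ and $y_i$. A trail is a sequence $\langle v_1,e_1,v_2,\ldots,e_{k-1},v_k\rangle$ with $e_i$ an edge joining $v_i$ and $v_{i+1}$ and no edge repeated (a single vertex is allowed). Trail Dual: for a vertex $u$, the Minimal Increasing Greedy Trail (MIGT) $T_u$ is the trail starting at $u$ that at each step takes, among the edges incident to the current vertex whose labels are larger than those of all previously used edges, the one with the smallest label, and stops when there is no such edge. (Each edge is used by exactly two of the trails $T_u$, $u\in[n]$.) The Trail Dual of a labeled graph $G$ is the labeled graph $G'$ on the same vertex set in which, for each label $k$, there is an edge labeled $k$ between the two vertices $x,y$ such that $T_x$ and $T_y$ both use the edge of $G$ labeled $k$. *)

(* Defs.v *)
(* Indices are 0-based: [n] is 'I_n and the edge labels [m] are 'I_m.         *)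
From HB Require Import structures.
From mathcomp Require Import all_boot all_fingroup.

Set Implicit Arguments.
Unset Strict Implicit.
Unset Printing Implicit Defensive.

Local Open Scope group_scope.

Section Transpositions.
Variable n : nat.

Definition is_transp_of (s : 'S_n) (p : 'I_n * 'I_n) : bool :=
  (p.1 != p.2) && (s == tperm p.1 p.2).

Record transposition := Transposition {
  transp_perm :> 'S_n;
  transp_permP : [exists p, is_transp_of transp_perm p] }.

HB.instance Definition _ := [isSub for transp_perm].
HB.instance Definition _ := [Equality of transposition by <:].

Fact transp_subproof (x y : 'I_n) :
  x != y -> [exists p, is_transp_of (tperm x y) p].
Proof. by move=> xy; apply/existsP; exists (x, y); rewrite /is_transp_of xy /=. Qed.

Definition transp (x y : 'I_n) (xy : x != y) : transposition :=
  Transposition (transp_subproof xy).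

(* A pair (x, y) such that t = (x, y), in one of its two orders; what is built
   from it below does not depend on the order (see above_transpE). *)
Definition transp_pair (t : transposition) : 'I_n * 'I_n :=
  xchoose (existsP (transp_permP t)).

Lemma transp_pairP (t : transposition) : is_transp_of t (transp_pair t).
Proof. exact: xchooseP. Qed.

Lemma transp_pair_neq t : (transp_pair t).1 != (transp_pair t).2.
Proof. by case/andP: (transp_pairP t). Qed.

End Transpositions.

Section MindBody.
Variables n m : nat.

(* A : 'S_n maps each mind to the body below it.  In 'S_n the left factor of a
   product acts first: (A * t) M = t (A M). *)
Definition body_swap (A : 'S_n) (t : transposition n) : 'S_n := A * t.

Definition assignment (s : m.-tuple (transposition n)) (k : nat) : 'S_n :=
  foldl body_swap 1 (take k s).

Definition above (A : 'S_n) (x : 'I_n) : 'I_n := A^-1 x.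

Fact above_neq A x y : x != y -> above A x != above A y.
Proof. by rewrite (inj_eq perm_inj). Qed.

Definition above_transp (A : 'S_n) (t : transposition n) : transposition n :=
  transp (above_neq A (transp_pair_neq t)).

Lemma above_transpE (A : 'S_n) (x y : 'I_n) (xy : x != y) :
  above_transp A (transp xy) = tperm (above A x) (above A y) :> 'S_n.
Proof.
have /andP[_ /eqP /= E] := transp_pairP (transp xy).
by rewrite /= /above -!tpermJ -E.
Qed.

(* With k counted from 0, the k-th transposition is read off from the
   assignment reached after the first k swaps. *)
Definition mind_body_dual (s : m.-tuple (transposition n)) :
    m.-tuple (transposition n) :=
  [tuple above_transp (assignment s k) (tnth s k) | k < m].

End MindBody.

Section Graphs.
Variables n m : nat.

(* The vertices are their own labels, and so are the edges; ends k is the set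
   of the two endpoints of edge k. *)
Record labeled_graph := LabeledGraph {
  ends : {ffun 'I_m -> {set 'I_n}};
  endsP : [forall k, #|ends k| == 2] }.

HB.instance Definition _ := [isSub for ends].
HB.instance Definition _ := [Equality of labeled_graph by <:].

Lemma card_ends G k : #|ends G k| = 2.
Proof. exact: eqP (forallP (endsP G) k). Qed.

Fact graph_of_tseq_subproof (s : m.-tuple (transposition n)) :
  let E := [ffun k => [set (transp_pair (tnth s k)).1;
                           (transp_pair (tnth s k)).2]] in
  [forall k : 'I_m, #|E k| == 2].
Proof. by apply/forallP=> k; rewrite ffunE cards2 transp_pair_neq. Qed.

Definition graph_of_tseq (s : m.-tuple (transposition n)) : labeled_graph :=
  LabeledGraph (graph_of_tseq_subproof s).

Fact edge_pair_subproof (G : labeled_graph) (k : 'I_m) :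
  exists p : 'I_n * 'I_n, (p.1 != p.2) && (ends G k == [set p.1; p.2]).
Proof.
have /cards2P[x [y [xy Ek]]] : #|ends G k| == 2 by rewrite card_ends.
by exists (x, y); rewrite xy Ek eqxx.
Qed.

Definition edge_pair (G : labeled_graph) (k : 'I_m) : 'I_n * 'I_n :=
  xchoose (edge_pair_subproof G k).

Lemma edge_pairP G k :
  ((edge_pair G k).1 != (edge_pair G k).2) &&
  (ends G k == [set (edge_pair G k).1; (edge_pair G k).2]).
Proof. exact: (xchooseP (edge_pair_subproof G k)). Qed.

Lemma edge_pair_neq G k : (edge_pair G k).1 != (edge_pair G k).2.
Proof. by case/andP: (edge_pairP G k). Qed.

Definition tseq_of_graph (G : labeled_graph) : m.-tuple (transposition n) :=
  [tuple transp (edge_pair_neq G k) | k < m].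

Lemma graph_of_tseqK : cancel graph_of_tseq tseq_of_graph.
Proof.
move=> s; apply: eq_from_tnth => k; rewrite tnth_mktuple; apply: val_inj => /=.
have /andP[_ /eqP->] := transp_pairP (tnth s k).
have /andP[ne /eqP] := edge_pairP (graph_of_tseq s) k; rewrite /= ffunE.
move: (edge_pair _ _) (transp_pair _) ne => [a b] [x y] /= ab E.
have := set21 a b; have := set22 a b; rewrite -E !inE.
move=> /orP[] /eqP eb /orP[] /eqP ea; subst => //; rewrite ?eqxx // in ab *.
by rewrite tpermC.
Qed.

Fact tperm_moved (a b : 'I_n) :
  a != b -> [set z | tperm a b z != z] = [set a; b].
Proof.
move=> ab; apply/setP=> z; rewrite !inE.
case: tpermP => [->|->|/eqP/negPf-> /eqP/negPf->]; last by rewrite eqxx.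
  by rewrite eq_sym ab eqxx.
by rewrite ab eqxx orbT.
Qed.

Lemma tseq_of_graphK : cancel tseq_of_graph graph_of_tseq.
Proof.
move=> G; apply: val_inj; apply/ffunP=> k; rewrite /= ffunE tnth_mktuple.
have /andP[ab /eqP->] := edge_pairP G k.
have /andP[xy /eqP E] := transp_pairP (transp (edge_pair_neq G k)).
by rewrite -(tperm_moved xy) -E tperm_moved.
Qed.

Definition other_end (G : labeled_graph) (e : 'I_m) (v : 'I_n) : 'I_n :=
  odflt v [pick w in ends G e :\ v].

Definition eligible (G : labeled_graph) (v : 'I_n) (used : seq 'I_m) :
    {set 'I_m} :=
  [set e | (v \in ends G e) && all (fun f : 'I_m => f < e) used].

Definition next_edge (G : labeled_graph) (v : 'I_n) (used : seq 'I_m) :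
    option 'I_m :=
  [pick e in eligible G v used |
    [forall f in eligible G v used, (e : nat) <= f]].

(* The edges taken from v onwards, each paired with the vertex it leads to. *)
Fixpoint greedy_trail (G : labeled_graph) (fuel : nat) (v : 'I_n)
    (used : seq 'I_m) : seq ('I_m * 'I_n) :=
  if fuel is fuel'.+1 then
    if next_edge G v used is Some e then
      let w := other_end G e v in
      (e, w) :: greedy_trail G fuel' w (e :: used)
    else [::]
  else [::].

(* The trail <u, e_1, v_2, e_2, v_3, ...> as u and the sequence of the
   (e_i, v_i+1).  The labels increase along it, so m steps are enough for it to
   stop only when no edge is eligible: see MIGT_stops. *)
Definition MIGT (G : labeled_graph) (u : 'I_n) : 'I_n * seq ('I_m * 'I_n) :=
  (u, greedy_trail G m u [::]).

Definition trail_edges (T : 'I_n * seq ('I_m * 'I_n)) : seq 'I_m :=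
  [seq step.1 | step <- T.2].

Definition trail_end (T : 'I_n * seq ('I_m * 'I_n)) : 'I_n :=
  last T.1 [seq step.2 | step <- T.2].

Lemma other_endP G e v : v \in ends G e ->
  (other_end G e v \in ends G e) && (other_end G e v != v).
Proof.
move=> ve; rewrite /other_end; case: pickP => [w|] /=.
  by rewrite !inE andbC => ->.
have := cardsD1 v (ends G e); rewrite card_ends ve => -[] /esym/eqP.
by move=> /cards1P[w Ew] /(_ w); rewrite Ew inE eqxx.
Qed.

Lemma other_endK G e v : v \in ends G e -> other_end G e (other_end G e v) = v.
Proof.
move=> ve; have /andP[we wv] := other_endP ve.
have /andP[ze zw] := other_endP we; apply/eqP/contraT => zv.
have : [set other_end G e v; v; other_end G e (other_end G e v)]
         \subset ends G e.
  by apply/subsetP=> t; rewrite !inE => /orP[/orP[]|] /eqP->.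
move=> /subset_leq_card; rewrite card_ends setUC cardsU1 cards2 !inE.
by rewrite wv (negPf zv) (negPf zw).
Qed.

(* walk G j d v is the position reached from v after scanning the labels
   j, ..., j + d - 1 in order and crossing each edge met at the current vertex.
   It serves to show that every edge lies on exactly two of the trails. *)
Definition cross G (j : nat) (v : 'I_n) : 'I_n :=
  if insub j is Some e then if v \in ends G e then other_end G e v else v
  else v.

Lemma crossK G j : involutive (cross G j).
Proof.
move=> v; rewrite /cross; case: insubP => [e _ _|_] //.
have [ve|/negPf ve] := boolP (v \in ends G e); last by rewrite ve.
by have /andP[-> _] := other_endP ve; rewrite other_endK.
Qed.

Definition walk G (j d : nat) (v : 'I_n) : 'I_n :=
  foldl (fun w i => cross G i w) v (iota j d).

Lemma walk_inj G j d : injective (walk G j d).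
Proof.
elim: d j => [|d IHd] j u v //= /IHd; exact: (inv_inj (crossK G j)).
Qed.

(* What remains of a trail after the labels below j have been scanned. *)
Lemma greedy_trailP G fuel j v used :
  m - j <= fuel -> all (fun f : 'I_m => f < j) used ->
  (forall f, f \in eligible G v used -> j <= f) ->
  let s := greedy_trail G fuel v used in
  (forall k : 'I_m, (k \in [seq x.1 | x <- s]) =
     (j <= k) && (walk G j (k - j) v \in ends G k)) /\
  next_edge G (last v [seq x.2 | x <- s]) (rev [seq x.1 | x <- s] ++ used)
    = None.
Proof.
elim: fuel j v used => [|fuel IHfuel] j.
  rewrite leqn0 subn_eq0 => v used le_mj _ ge_j /=; split=> [k|].
    by rewrite in_nil leqNgt (leq_trans (ltn_ord k) le_mj).
  rewrite /next_edge; case: pickP => // f /andP[/ge_j le_jf _].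
  by have := ltn_ord f; rewrite ltnNge (leq_trans le_mj le_jf).
have [d] := ubnP (m - j); elim: d j => // d IHd j ltd v used fuel_ok used_lt ge_j.
have [le_mj|lt_jm] := leqP m j.
  have -> : greedy_trail G fuel.+1 v used = [::].
    rewrite /= /next_edge; case: pickP => // f /andP[/ge_j le_jf _].
    by have := ltn_ord f; rewrite ltnNge (leq_trans le_mj le_jf).
  split=> [k|] /=.
    by rewrite in_nil leqNgt (leq_trans (ltn_ord k) le_mj).
  rewrite /next_edge; case: pickP => // f /andP[/ge_j le_jf _].
  by have := ltn_ord f; rewrite ltnNge (leq_trans le_mj le_jf).
have walkS (k : 'I_m) : j < k -> walk G j (k - j) v = walk G j.+1 (k - j.+1) (cross G j v).
  by move=> lt_jk; rewrite subnS /walk -[in LHS](prednK (n := k - j)) ?subn_gt0.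
pose e := Ordinal lt_jm.
have cross_j : cross G j v = if v \in ends G e then other_end G e v else v.
  by rewrite /cross insubT.
have [ve|nve] := boolP (v \in ends G e).
  have e_elig : e \in eligible G v used by rewrite inE ve.
  have next_e : next_edge G v used = Some e.
    rewrite /next_edge; case: pickP => [f /andP[f_elig /forall_inP f_min]|].
      congr Some; apply/val_inj/eqP; rewrite eqn_leq f_min //=.
      exact: ge_j.
    by move=> /(_ e); rewrite e_elig /= => /negbT/forall_inP[] f /ge_j.
  have := IHfuel j.+1 (other_end G e v) (e :: used).
  case=> [|||uses stops].
  - by rewrite subnS -ltnS (leq_trans _ fuel_ok) // prednK ?subn_gt0.
  - by rewrite /= ltnSn; apply: sub_all used_lt => f /ltnW.
  - by move=> f; rewrite inE /= => /and3P[].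
  rewrite /= next_e /=; split=> [k|].
    rewrite in_cons uses; have [lt_jk|lt_kj|eq_jk] := ltngtP j k.
    + by rewrite walkS // cross_j ve -val_eqE /= gtn_eqF.
    + by rewrite -val_eqE /= ltn_eqF.
    + by rewrite -val_eqE /= -eq_jk eqxx subnn /walk /= (_ : k = e) //; apply: val_inj.
  by rewrite rev_cons cat_rcons.
have [||||uses stops] := IHd j.+1 _ v used.
- by rewrite subnS -ltnS prednK ?subn_gt0.
- by rewrite subnS (leq_trans (leq_pred _)).
- by apply: sub_all used_lt => f /ltnW.
- move=> f f_elig; rewrite ltn_neqAle ge_j // andbT.
  apply: contraNneq nve => jf; rewrite (_ : e = f); last exact: val_inj.
  by move: f_elig; rewrite inE => /andP[].
split=> // k; rewrite uses; have [lt_jk|//|eq_jk] := ltngtP j k.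
  by rewrite walkS // cross_j (negPf nve).
rewrite -eq_jk subnn /walk /= (_ : k = e) ?(negPf nve) //; exact: val_inj.
Qed.

Lemma MIGT_uses G u (k : 'I_m) :
  (k \in trail_edges (MIGT G u)) = (walk G 0 k u \in ends G k).
Proof.
have [||//|uses _] := @greedy_trailP G m 0 u [::]; rewrite ?subn0 //.
by rewrite [LHS]uses subn0.
Qed.

Lemma MIGT_stops G u :
  next_edge G (trail_end (MIGT G u)) (rev (trail_edges (MIGT G u))) = None.
Proof.
have [||//|_] := @greedy_trailP G m 0 u [::]; rewrite ?subn0 //.
by rewrite cats0.
Qed.

Fact trail_dual_subproof (G : labeled_graph) :
  let E := [ffun k => [set u | k \in trail_edges (MIGT G u)]] in
  [forall k : 'I_m, #|E k| == 2].
Proof.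
apply/forallP=> k; rewrite ffunE.
have -> : [set u | k \in trail_edges (MIGT G u)] = walk G 0 k @^-1: ends G k.
  by apply/setP=> u; rewrite !inE MIGT_uses.
by rewrite card_preimset ?card_ends //; apply: walk_inj.
Qed.

(* Edge k of the dual joins the two vertices whose trails use edge k of G. *)
Definition trail_dual (G : labeled_graph) : labeled_graph :=
  LabeledGraph (trail_dual_subproof G).

End Graphs.

(* Main.v *)
(* The trail from u uses edge k exactly when scanning the labels below k, and
   crossing each edge met at the current vertex, leads from u to an end of edge
   k.  Crossing edge j is the transposition s_j, so the scan is the product
   A = s_1 ... s_(k-1), i.e. the assignment before the k-th swap.  Hence edge k
   of the Trail Dual joins the preimages under A of the ends of s_k, which are
   the minds above them. *)
Require Import Defs.
From mathcomp Require Import all_boot all_fingroup.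

Set Implicit Arguments.
Unset Strict Implicit.
Unset Printing Implicit Defensive.

Local Open Scope group_scope.

(** Conjugation does not mention the pair chosen by [transp_pair], so endpoints need not be named in
    the main argument. *)
Lemma above_transp_conj n (A : 'S_n) (t : transposition n) :
  above_transp A t = transp_perm t ^ A^-1 :> 'S_n.
Proof. by case/andP: (transp_pairP t) => _ /eqP ->; rewrite tpermJ. Qed.

Section WalkOfSequence.
Variables n m : nat.
Implicit Types (s : m.-tuple (transposition n)) (k : 'I_m) (v : 'I_n).

Lemma ends_graph_of_tseq s k :
  ends (graph_of_tseq s) k = [set z | tnth s k z != z].
Proof.
case/andP: (transp_pairP (tnth s k)) => ne /eqP ->.
by rewrite tperm_moved // ffunE.
Qed.

Lemma other_end_graph_of_tseq s k v :
  v \in ends (graph_of_tseq s) k ->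
  other_end (graph_of_tseq s) k v = tnth s k v.
Proof.
move=> vk; have /andP[] := other_endP vk; move: vk.
case/andP: (transp_pairP (tnth s k)) => _ /eqP ->; rewrite /= ffunE !inE.
by case/orP=> /eqP-> /orP[] /eqP->; rewrite ?eqxx // (tpermL, tpermR).
Qed.

Lemma cross_graph_of_tseq s k v : cross (graph_of_tseq s) k v = tnth s k v.
Proof.
rewrite /cross valK; case: ifPn => [/other_end_graph_of_tseq //|].
by rewrite ends_graph_of_tseq inE negbK => /eqP.
Qed.

Lemma walk_graph_of_tseq s j v :
  j <= m -> walk (graph_of_tseq s) 0 j v = assignment s j v.
Proof.
elim: j => [|j IHj] lt_jm; first by rewrite /assignment take0 perm1.
pose k := Ordinal lt_jm.
have -> : assignment s j.+1 = assignment s j * transp_perm (tnth s k).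
  rewrite /assignment (take_nth (tnth s k)) ?size_tuple // foldl_rcons.
  by rewrite [in RHS](tnth_nth (tnth s k)).
rewrite permM -IHj 1?ltnW // -cross_graph_of_tseq /walk.
by rewrite -addn1 iotaD foldl_cat add0n.
Qed.

End WalkOfSequence.

Theorem theorem4p2 (n m : nat) (s : m.-tuple (transposition n)) :
  mind_body_dual s = tseq_of_graph (trail_dual (graph_of_tseq s)).
Proof.
(* Both sides become images under [tseq_of_graph], so it suffices to compare the endpoint sets label
   by label. *)
rewrite -[LHS]graph_of_tseqK; congr tseq_of_graph; apply: val_inj.
apply/ffunP=> k; rewrite [LHS]ends_graph_of_tseq tnth_mktuple.
rewrite above_transp_conj /= ffunE.
apply/setP=> u; rewrite !inE MIGT_uses walk_graph_of_tseq 1?ltnW //.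
(* With [A] the assignment and [t] the swap at [k], [A * t * A^-1] moves [u] exactly when [t] moves
   [A u]. *)
by rewrite ends_graph_of_tseq inE /conjg invgK !permM (can2_eq (permKV _) (permK _)).
Qed.
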